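(* Let $G=(I,\mu,E)$ be a connected graphing. Then $\lambda_G\ge \dfrac{h_G^2}{8}$.
   Context: Let $I=[0,1]$. A bounded degree Borel graph on $I$ is a symmetric Borel set $E\subseteq I^2$ such that for some integer $D$, $|\{y:(x,y)\in E\}|\le D$ for all $x\in I$. For Borel $A\subseteq I$ let $\deg_A(x)=|\{y\in A:(x,y)\in E\}|$ and $\deg=\deg_I$. A graphing is a triple $G=(I,\mu,E)$ where $E$ is a bounded degree Borel graph and $\mu$ is a Borel probability measure on $I$ with $\int_A\deg_B\,d\mu=\int_B\deg_A\,d\mu$ for all Borel $A,B\subseteq I$. Its edge measure $\eta$ is the Borel measure on $I^2$ determined by $\eta(A\times B)=\int_A\deg_B\,d\mu$. Put $e_G(A,B)=\eta(A\times B)$ and $\mathrm{vol}_G(A)=\int_A\deg\,d\mu$. $G$ is connected if $e_G(A,A^c)\ne0$ for every Borel $A$ with $0<\mu(A)<1$. The Cheeger constant is $h_G=\inf_{A:\,0<\mu(A)<1}\frac{e_G(A,A^c)}{\min\{\mathrm{vol}_G(A),\mathrm{vol}_G(A^c)\}}$. For measurable $f:I\to\mathbb R$ set $\|f\|_v^2=\int_I f^2\deg\,d\mu$ and $\|df\|_e^2=\frac12\int_{I^2}(f(y)-f(x))^2\,d\eta(x,y)$. The bottom of the spectrum of the Laplacian is $\lambda_G=\inf\{\|df\|_e^2/\|f\|_v^2:\ 0<\|f\|_v<\infty,\ \int_I f\deg\,d\mu=0\}$. *)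

(* Defs.v *)
From HB Require Import structures.
From mathcomp Require Import all_boot all_order all_algebra.
From mathcomp Require Import all_classical all_reals all_analysis.
Set Implicit Arguments. Unset Strict Implicit. Unset Printing Implicit Defensive.
Import Order.TTheory GRing.Theory Num.Theory.
Local Open Scope classical_set_scope.
Local Open Scope ring_scope.
Local Open Scope ereal_scope.

Section Graphing.
Variable R : realType.

Definition I01 : set R := `[0%R, 1%R]%classic.

Definition degA (E : set (R * R)) (A : set R) (x : R) : \bar R :=
  \esum_(y in [set y | A y /\ E (x, y)]) 1.

Definition bounded_degree_Borel_graph (E : set (R * R)) : Prop :=
  measurable E /\ E `<=` I01 `*` I01 /\
  (forall x y, E (x, y) -> E (y, x)) /\
  exists D : nat, forall x, degA E I01 x <= D%:R%:E.

Definition prob_on_I (mu : {measure set R -> \bar R}) : Prop :=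
  mu setT = 1 /\ mu I01 = 1.

Definition is_graphing (mu : {measure set R -> \bar R}) (E : set (R * R)) : Prop :=
  bounded_degree_Borel_graph E /\ prob_on_I mu /\
  forall A B, measurable A -> measurable B -> A `<=` I01 -> B `<=` I01 ->
    \int[mu]_(x in A) degA E B x = \int[mu]_(x in B) degA E A x.

Definition is_edge_measure (mu : {measure set R -> \bar R}) (E : set (R * R))
    (eta : {measure set (R * R) -> \bar R}) : Prop :=
  forall A B, measurable A -> measurable B ->
    eta (A `*` B) = \int[mu]_(x in A) degA E B x.

Definition eG (eta : {measure set (R * R) -> \bar R}) (A B : set R) : \bar R :=
  eta (A `*` B).

Definition volG (mu : {measure set R -> \bar R}) (E : set (R * R)) (A : set R) : \bar R :=
  \int[mu]_(x in A) degA E I01 x.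

Definition connected_graphing (mu : {measure set R -> \bar R})
    (eta : {measure set (R * R) -> \bar R}) : Prop :=
  forall A, measurable A -> A `<=` I01 -> 0 < mu A < 1 ->
    eG eta A (I01 `\` A) != 0.

(* Cheeger constant (infimum in the extended reals; all quotients are finite) *)
Definition cheeger (mu : {measure set R -> \bar R}) (E : set (R * R))
    (eta : {measure set (R * R) -> \bar R}) : \bar R :=
  ereal_inf [set r | exists A, [/\ measurable A, A `<=` I01, 0 < mu A < 1 &
     r = (fine (eG eta A (I01 `\` A)) /
          fine (Order.min (volG mu E A) (volG mu E (I01 `\` A))))%R%:E]].

Definition normv2 (mu : {measure set R -> \bar R}) (E : set (R * R)) (f : R -> R) : \bar R :=
  \int[mu]_x (((f x) ^+ 2)%R%:E * degA E I01 x).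

Definition norme2 (eta : {measure set (R * R) -> \bar R}) (f : R -> R) : \bar R :=
  (2^-1)%R%:E * \int[eta]_p (((f p.2 - f p.1) ^+ 2)%R%:E).

(* bottom of the spectrum of the Laplacian *)
Definition lambdaG (mu : {measure set R -> \bar R}) (E : set (R * R))
    (eta : {measure set (R * R) -> \bar R}) : \bar R :=
  ereal_inf [set r | exists f : R -> R, [/\ measurable_fun setT f,
     0 < normv2 mu E f < +oo,
     \int[mu]_x ((f x)%:E * degA E I01 x) = 0 &
     r = norme2 eta f * ((fine (normv2 mu E f))^-1)%R%:E]].

End Graphing.

(* Main.v *)
(* Let nu be the first marginal of eta, that is, deg dmu.  Replace f by
   g = f - c with c a median of f for nu; since f has mean zero this does not
   decrease the norm.  Put F = g |g|.
   The Cheeger bound for the level sets {F > t}, integrated over t (layer cake),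
   gives h ||g||^2 <= int (F x - F y)^+ d eta, and AM-GM bounds the right-hand
   side by (2/h) int (g y - g x)^2 d eta + (h/2) ||g||^2.

   Measurability of deg would require the Lusin-Novikov theorem.  It is avoided:
   the library's integral of a nonnegative function is its lower integral, and
   a measurable minorant of deg with the same integral suffices to identify
   int phi deg dmu with int phi dnu. *)
Require Import Defs.
From HB Require Import structures.
From mathcomp Require Import all_boot all_order all_algebra.
From mathcomp Require Import all_classical all_reals all_analysis measurable_realfun.
From mathcomp Require Import ring lra.
Set Implicit Arguments. Unset Strict Implicit. Unset Printing Implicit Defensive.
Import Order.TTheory GRing.Theory Num.Theory.
Local Open Scope classical_set_scope.
Local Open Scope ring_scope.
Local Open Scope ereal_scope.

(** * Lower integrals against a density that may fail to be measurable *)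

Section lower_integral.
Import HBNNSimple.
Context d (T : measurableType d) (R : realType).
Implicit Types mu nu : {finite_measure set T -> \bar R}.

(** No measurability is required: every simple function below [f] is also below [g], so the supremum
    defining the integral can only grow. *)
Lemma ge0_le_lower_integral (mu : {measure set T -> \bar R}) (D : set T)
    (f g : T -> \bar R) :
  (forall x, D x -> 0 <= f x) -> (forall x, D x -> f x <= g x) ->
  \int[mu]_(x in D) f x <= \int[mu]_(x in D) g x.
Proof.
move=> f0 fg; have g0 x : D x -> 0 <= g x.
  by move=> Dx; exact: le_trans (f0 x Dx) (fg x Dx).
rewrite !ge0_integralE//; apply: le_ereal_sup => _ [h hf <-].
exists h => //= x; apply: le_trans (hf x) _.
by rewrite !patchE; case: ifPn => // /set_mem; exact: fg.
Qed.

(** The integral of [u] is a supremum over simple functions below [u]. A sequence of them whose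
    integrals tend to that supremum has a pointwise supremum that is measurable, stays below [u] and
    loses no mass. *)
Lemma measurable_minorant (mu : {measure set T -> \bar R}) (u : T -> \bar R) :
  (forall x, 0 <= u x) ->
  exists g : T -> \bar R, [/\ measurable_fun setT g, forall x, 0 <= g x,
    forall x, g x <= u x & \int[mu]_x g x = \int[mu]_x u x].
Proof.
move=> u0; have uE := ge0_integralTE mu u0.
set S := (X in _ = ereal_sup X) in uE.
have /ereal_sup_seq[s sS scvg] : S != set0.
  by apply/set0P; exists (sintegral mu (@nnsfun0 _ T R)), (@nnsfun0 _ T R).
have /choice[h hP] n : exists h : {nnsfun T >-> R},
    (forall x, (h x)%:E <= u x) /\ sintegral mu h = s n.
  by have [h hu hs] := sS n; exists h.
(* At index 0 [esups] is the supremum of the whole sequence. *)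
pose g x := esups (fun n => (h n x)%:E) 0%N.
have mg : measurable_fun setT g.
  apply: (@measurable_fun_esups _ _ _ setT (fun n x => (h n x)%:E)) => n.
  by apply/measurable_EFinP.
have hg n x : (h n x)%:E <= g x by apply: ereal_sup_ubound; exists n.
have g0 x : 0 <= g x by apply: le_trans (hg 0%N x); rewrite lee_fin.
have gu x : g x <= u x.
  by apply: ge_ereal_sup => _ [n _ <-]; exact: (hP n).1.
exists g; split => //; apply/eqP; rewrite eq_le; apply/andP; split.
  exact: ge0_le_lower_integral.
rewrite uE; apply: (cvge_to_le scvg); apply: nearW => n.
rewrite -(hP n).2 -integralT_nnsfun.
by apply: ge0_le_lower_integral => x _; rewrite ?lee_fin.
Qed.

(** A measurable density agrees [mu]-almost everywhere with the Radon-Nikodym derivative, for which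
    the change of variables is known. *)
Lemma density_integral mu nu (k : T -> \bar R) (phi : T -> \bar R) :
  measurable_fun setT k -> (forall x, 0 <= k x) ->
  (forall A, measurable A -> \int[mu]_(x in A) k x = nu A) ->
  measurable_fun setT phi -> (forall x, 0 <= phi x) ->
  \int[mu]_x (phi x * k x) = \int[nu]_x phi x.
Proof.
move=> mk k0 kE mphi phi0.
have numu : nu `<< mu.
  apply/null_content_dominatesP => A mA muA0; rewrite -kE//.
  by apply: null_set_integral => //; exact: measurable_funTS.
rewrite -(Radon_Nikodym_SigmaFinite.change_of_variables numu)//.
pose rn := Radon_Nikodym_SigmaFinite.f nu mu.
have mrn : measurable_fun setT rn.
  exact: measurable_int (Radon_Nikodym_SigmaFinite.f_integrable numu).
apply: ge0_ae_eq_integral => //.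
- exact: emeasurable_funM.
- exact: emeasurable_funM.
- by move=> x _; rewrite mule_ge0.
- by move=> x _; rewrite mule_ge0// Radon_Nikodym_SigmaFinite.f_ge0.
have : ae_eq mu setT rn k.
  apply: integral_ae_eq => //.
    exact: Radon_Nikodym_SigmaFinite.f_integrable.
  by move=> A _ mA; rewrite kE// -Radon_Nikodym_SigmaFinite.f_integral.
by apply: filterS => x /= /(_ I) rk _; rewrite -/rn rk.
Qed.


(** Any measurable [k] between the minorant [g] and [u] is a genuine density of [nu]. The choice
    [k = g] gives one inequality; for the other, [k] is adapted to each simple function below
    [phi * u]. *)
Lemma lower_integral_density mu nu (u : T -> \bar R) (phi : T -> R) :
  (forall x, 0 <= u x) ->
  (forall A, measurable A -> \int[mu]_(x in A) u x = nu A) ->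
  measurable_fun setT phi -> (forall x, (0 <= phi x)%R) ->
  \int[mu]_x ((phi x)%:E * u x) = \int[nu]_x (phi x)%:E.
Proof.
move=> u0 uE mphi phi0.
have [g [mg g0 gu gE]] := measurable_minorant mu u0.
have phiT0 x : 0 <= (phi x)%:E by rewrite lee_fin.
have mephi : measurable_fun setT (EFin \o phi) by exact/measurable_EFinP.
(* The integral of [k] is at most [nu] on [A] and on its complement, while the totals agree because
   [g] already has full mass. As [nu] is finite, equality must hold on [A]. *)
have density k : measurable_fun setT k -> (forall x, g x <= k x) ->
    (forall x, k x <= u x) ->
    \int[mu]_x ((phi x)%:E * k x) = \int[nu]_x (phi x)%:E.
  move=> mk gk ku; have k0 x : 0 <= k x by exact: le_trans (gk x).
  apply: density_integral => // A mA; apply/eqP; rewrite eq_le; apply/andP; split.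
    by rewrite -uE//; exact: ge0_le_lower_integral.
  have kT : \int[mu]_x k x = nu setT.
    apply/eqP; rewrite eq_le -uE// ge0_le_lower_integral//=.
    by rewrite -gE ge0_le_lower_integral.
  have kC : \int[mu]_(x in ~` A) k x <= nu (~` A).
    by rewrite -uE; [exact: ge0_le_lower_integral|exact: measurableC].
  have nuAE : nu setT = nu A + nu (~` A).
    rewrite -measureU ?setUv//; [exact: measurableC|exact: setICr].
  have kAE : \int[mu]_x k x = \int[mu]_(x in A) k x + \int[mu]_(x in ~` A) k x.
    rewrite -ge0_integral_setU ?setUv//; first exact: measurableC.
    exact/disj_set2P/setICr.
  rewrite -(@leeD2rE _ (nu (~` A))) ?fin_num_measure//; last exact: measurableC.
  by rewrite -nuAE -kT kAE leeD2l.
apply/eqP; rewrite eq_le; apply/andP; split; last first.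
  rewrite -(density g)//; apply: ge0_le_lower_integral => x _.
    exact: mule_ge0.
  exact: lee_wpmul2l.
(* For a simple [h] below [phi * u], the function [k = max(g, h / phi)] lies between [g] and [u],
   and [h] is below [phi * k]. Where [phi] vanishes the inverse is 0 by convention, so [k = g]
   there, and [h] is nonpositive. *)
rewrite ge0_integralTE; last by move=> x; exact: mule_ge0.
apply: ge_ereal_sup => _ [h hu <-]; rewrite -integralT_nnsfun.
(* [powR] rather than [^-1], whose measurability is not in the library. *)
have powE x : (phi x `^ (-1))%R = (phi x)^-1%R by rewrite powR_inv1.
pose k x := maxe (g x) (h x * phi x `^ (-1))%R%:E.
rewrite -(density k).
- apply: ge0_le_lower_integral => x _; first by rewrite lee_fin.
  have [phix0|phix0] := eqVneq (phi x) 0%R.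
    by have := hu x; rewrite phix0 !mul0e.
  rewrite /k powE maxe_pMr//= le_max; apply/orP; right.
  by rewrite -EFinM mulrC divfK.
- apply: measurable_maxe => //; apply/measurable_EFinP; apply: measurable_funM => //.
  apply: (@measurableT_comp _ _ _ _ _ _ (fun y => powR y (-1)%R)) => //.
- by move=> x; rewrite /k le_max lexx.
- move=> x; rewrite /k powE ge_max gu/=.
  have [phix0|phix0] := eqVneq (phi x) 0%R; first by rewrite phix0 invr0 mulr0.
  have phix_gt0 : (0 < phi x)%R by rewrite lt_neqAle eq_sym phix0 phi0.
  rewrite -(@lee_pmul2l _ (phi x)%:E)//.
  by rewrite -EFinM mulrC divfK.
Qed.

End lower_integral.

(** * Level sets, layer cake, medians and a pointwise inequality *)

Lemma measurable_set_le d (T : measurableType d) (R : realType) (f g : T -> R) :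
  measurable_fun setT f -> measurable_fun setT g ->
  measurable [set x | (f x <= g x)%R].
Proof.
move=> mf mg; have : measurable_fun setT (fun x => f x <= g x)%R.
  exact: measurable_fun_ler.
by move=> /(_ measurableT [set true]); rewrite setTI; exact.
Qed.

Lemma measurable_set_lt d (T : measurableType d) (R : realType) (f g : T -> R) :
  measurable_fun setT f -> measurable_fun setT g ->
  measurable [set x | (f x < g x)%R].
Proof.
move=> mf mg; have : measurable_fun setT (fun x => f x < g x)%R.
  exact: measurable_fun_ltr.
by move=> /(_ measurableT [set true]); rewrite setTI; exact.
Qed.

(** Tonelli for the region between the graphs of [b] and [a]: its sections over [x] are half-open
    intervals of length [max(a x - b x, 0)], its sections at height [t] are the sets on the
    right. *)
Lemma layer_cake d (T : measurableType d) (R : realType)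
    (m : {finite_measure set T -> \bar R}) (a b : T -> R) :
  measurable_fun setT a -> measurable_fun setT b ->
  measurable_fun setT (fun t : R => m [set x | (b x <= t < a x)%R]) /\
  \int[m]_x (Num.max (a x - b x) 0)%R%:E =
  \int[lebesgue_measure]_t m [set x | (b x <= t < a x)%R].
Proof.
move=> ma mb.
pose A : set (T * R) := [set p | (b p.1 <= p.2 < a p.1)%R].
have mA : measurable A.
  have -> : A = [set p | (b p.1 <= p.2)%R] `&` [set p | (p.2 < a p.1)%R].
    by apply/seteqP; split => p /= /andP.
  by apply: measurableI; [apply: measurable_set_le|apply: measurable_set_lt];
    rewrite //; exact: measurableT_comp.
have yA t : ysection A t = [set x | (b x <= t < a x)%R].
  by rewrite ysectionE.
split.
  under eq_fun do rewrite -yA.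
  exact: measurable_fun_ysection.
have := indic_fubini_tonelli m (@lebesgue_measure R) mA.
rewrite indic_fubini_tonelli_FE// indic_fubini_tonelli_GE//.
under [in X in _ = X -> _]eq_integral do rewrite /= yA.
move=> <-; apply: eq_integral => x _ /=.
have -> : xsection A x = `[b x, a x[%classic.
  by apply/seteqP; split => t /=; rewrite /xsection/= inE/= in_itv.
rewrite lebesgue_measure_itv/= lte_fin; case: ltP => ab.
  by rewrite -EFinB max_l// subr_ge0 ltW.
by rewrite max_r// subr_le0.
Qed.

(** The median is the infimum of the levels above which [f] carries at most half of the mass;
    continuity of [m] along monotone sequences controls both strict sides. *)
Lemma median_exists d (T : measurableType d) (R : realType)
    (m : {finite_measure set T -> \bar R}) (f : T -> R) :
  measurable_fun setT f ->
  exists c : R, m [set x | (f x > c)%R] <= m [set x | (f x <= c)%R] /\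
                m [set x | (f x < c)%R] <= m [set x | (f x >= c)%R].
Proof.
move=> mf.
have mgt c : measurable [set x | (c < f x)%R].
  exact: measurable_set_lt.
have mlt c : measurable [set x | (f x < c)%R].
  exact: measurable_set_lt.
have gtC c : ~` [set x | (c < f x)%R] = [set x | (f x <= c)%R].
  by apply/funext => x; apply/propext => /=; rewrite leNgt; split => /negP.
have ltC c : ~` [set x | (f x < c)%R] = [set x | (c <= f x)%R].
  by apply/funext => x; apply/propext => /=; rewrite leNgt; split => /negP.
pose V := fine (m setT).
have V0 : (0 <= V)%R by exact: fine_ge0.
have mTE : m setT = V%:E by rewrite fineK// fin_num_measure.
(* A set carrying at most half of the mass weighs no more than its complement, so it is enough to
   bound both strict sides by [V / 2]. *)
have half A : measurable A -> m A <= (V / 2)%:E -> m A <= m (~` A).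
  move=> mA; have mCA := measurableC mA.
  have : m setT = m A + m (~` A).
    by rewrite -measureU ?setUv//; exact: setICr.
  rewrite mTE -(@fineK _ (m A)) ?fin_num_measure//.
  rewrite -(@fineK _ (m (~` A))) ?fin_num_measure// !lee_fin => -[VE].
  by lra.
suff [c [c1 c2]] : exists c, m [set x | (c < f x)%R] <= (V / 2)%:E /\
                        m [set x | (f x < c)%R] <= (V / 2)%:E.
  by exists c; rewrite -gtC -ltC; split; exact: half.
(* For zero total mass the set [S] below would be the whole line and have no infimum; any level then
   serves. *)
have [V_eq0|V_neq0] := eqVneq V 0%R.
  exists 0%R; rewrite V_eq0 mul0r -V_eq0 -mTE.
  by split; apply: le_measure => //; rewrite inE.
have V_gt0 : (0 < V)%R by rewrite lt_neqAle eq_sym V_neq0.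
(* [S] is upward closed. It is nonempty because the sets [f > n] decrease to the empty set, and
   bounded below because the sets [f > -n] increase to the whole space, of mass [V > V / 2]. *)
pose S : set R := [set c | m [set x | (c < f x)%R] <= (V / 2)%:E].
have Sup c c' : S c -> (c <= c')%R -> S c'.
  move=> Sc cc'; apply: le_trans Sc; apply: le_measure; rewrite ?inE//.
  by move=> x /=; exact: le_lt_trans.
have S0 : S !=set0.
  apply/set0P/negP => /eqP SE.
  have : m (\bigcap_n [set x | (n%:R < f x)%R]) >= (V / 2)%:E.
    apply: (@cvge_to_ge _ \oo _ _ (fun n => m [set x | (n%:R < f x)%R])).
      apply: nonincreasing_cvg_mu => //.
      - by rewrite ltey_eq fin_num_measure.
      - exact: bigcap_measurableType.
      - move=> i j ij; apply/subsetPset => x /=; apply: le_lt_trans.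
        by rewrite ler_nat.
    apply: nearW => n; apply: ltW; rewrite ltNge; apply/negP => Sn.
    by have : S n%:R by []; rewrite SE.
  rewrite (_ : \bigcap_n _ = set0) ?measure0 ?lee_fin; first by lra.
  rewrite -subset0 => x /= /(_ (Num.trunc `|f x|).+1 I) /=; apply/negP.
  rewrite -leNgt ltW// (le_lt_trans (ler_norm _))//.
  exact: truncnS_gt.
have Slb : has_lbound S.
  apply: contrapT => nlb.
  have : m (\bigcup_n [set x | (- n%:R < f x)%R]) <= (V / 2)%:E.
    apply: (@cvge_to_le _ \oo _ _ (fun n => m [set x | (- n%:R < f x)%R])).
      apply: nondecreasing_cvg_mu => //.
      - exact: bigcup_measurable.
      - move=> i j ij; apply/subsetPset => x /=; apply: le_lt_trans.
        by rewrite lerN2 ler_nat.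
    apply: nearW => n; apply: contrapT => nS; apply: nlb; exists (- n%:R)%R => c Sc.
    by rewrite leNgt; apply/negP => /ltW cn; apply: nS; exact: Sup cn.
  rewrite (_ : \bigcup_n _ = setT) ?mTE ?lee_fin; first by lra.
  rewrite -subTset => x _ /=; exists (Num.trunc `|f x|).+1 => //=.
  rewrite ltrNl (le_lt_trans (ler_norm _))// normrN.
  exact: truncnS_gt.
exists (inf S); split.
(* The levels [inf S + 1 / (n + 1)] belong to [S], and the sets above them increase to the set
   [f > inf S]. *)
- rewrite (_ : [set x | _] = \bigcup_n [set x | (inf S + n.+1%:R^-1 < f x)%R]); last first.
    apply/seteqP; split => x /=.
      rewrite -subr_gt0 => fx; exists (Num.trunc (f x - inf S)^-1) => //=.
      rewrite -ltrBrDl invf_plt ?posrE//.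
      exact: truncnS_gt.
    by move=> [n _ /=]; apply: le_lt_trans; rewrite lerDl.
  apply: (@cvge_to_le _ \oo _ _ (fun n => m [set x | (inf S + n.+1%:R^-1 < f x)%R])).
    apply: nondecreasing_cvg_mu => //.
    - exact: bigcup_measurable.
    - move=> i j ij; apply/subsetPset => x /=; apply: le_lt_trans.
      by rewrite lerD2l lef_pV2 ?posrE// ler_nat.
  apply: nearW => n.
  have [c Sc cS] : exists2 c, S c & (c < inf S + n.+1%:R^-1)%R.
    by apply: inf_adherent => //; split.
  exact: Sup (ltW cS).
(* The levels [inf S - 1 / (n + 1)] are outside [S]: more than half of the mass lies above each,
   hence less than half at or below it. *)
- rewrite (_ : [set x | _] = \bigcup_n [set x | (f x < inf S - n.+1%:R^-1)%R]); last first.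
    apply/seteqP; split => x /=.
      rewrite -subr_gt0 => fx; exists (Num.trunc (inf S - f x)^-1) => //=.
      rewrite ltrBrDl -ltrBrDr invf_plt ?posrE//.
      exact: truncnS_gt.
    by move=> [n _ /=] /lt_le_trans; apply; rewrite gerBl.
  apply: (@cvge_to_le _ \oo _ _ (fun n => m [set x | (f x < inf S - n.+1%:R^-1)%R])).
    apply: nondecreasing_cvg_mu => //.
    - exact: bigcup_measurable.
    - move=> i j ij; apply/subsetPset => x /= /lt_le_trans; apply.
      by rewrite lerD2l lerN2 lef_pV2 ?posrE// ler_nat.
  apply: nearW => n; set c := (inf S - _)%R.
  have : ~ S c.
    move=> Sc; have := ge_inf Slb Sc; apply/negP; rewrite -ltNge.
    by rewrite gtrBl.
  rewrite /S/= => /negP; rewrite -ltNge => Vc.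
  have : m [set x | (f x <= c)%R] <= (V / 2)%:E.
    have : m setT = m [set x | (c < f x)%R] + m [set x | (f x <= c)%R].
      by rewrite -gtC -measureU ?setUv//; [exact: measurableC|exact: setICr].
    move: Vc; rewrite mTE -gtC -(@fineK _ (m [set x | (c < f x)%R])) ?fin_num_measure//.
    rewrite -(@fineK _ (m (~` _))) ?fin_num_measure//; last exact: measurableC.
    by rewrite lte_fin lee_fin => Vc [VE]; lra.
  apply: le_trans; apply: le_measure; rewrite ?inE//.
    by rewrite -gtC; exact: measurableC.
  by move=> x /=; exact: ltW.
Qed.

(* The right-hand side comes from AM-GM applied to [(a - b) * (`|a| + `|b|)]. *)
Lemma signed_square_diff_le (R : realType) (h a b : R) : (0 < h)%R ->
  (a * `|a| - b * `|b| <=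
   2 / h * (b - a) ^+ 2 + (h / 4 * a ^+ 2 + h / 4 * b ^+ 2))%R.
Proof.
move=> h0.
(* The completed square yields [2 / h * (b - a)^2 + h / 8 * w^2]; the assumption on [w] then turns
   [h / 8] into the two terms with [h / 4]. *)
have key (w : R) : (w ^+ 2 <= 2 * (a ^+ 2 + b ^+ 2) ->
    (a - b) * w <= 2 / h * (b - a) ^+ 2 + (h / 4 * a ^+ 2 + h / 4 * b ^+ 2))%R.
  move=> hw.
  have sq : (0 <= 2 / h * ((a - b) - h / 4 * w) ^+ 2)%R.
    by rewrite mulr_ge0 ?sqr_ge0// divr_ge0// ltW.
  have -> : ((a - b) * w =
      2 / h * (b - a) ^+ 2 + h / 8 * w ^+ 2 - 2 / h * ((a - b) - h / 4 * w) ^+ 2)%R.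
    by field; rewrite gt_eqF.
  have : (h / 8 * w ^+ 2 <= h / 8 * (2 * (a ^+ 2 + b ^+ 2)))%R.
    by rewrite ler_wpM2l// divr_ge0// ltW.
  by lra.
(* In each sign pattern [w] is [|a| + |b|], except for [a < 0 <= b], where the left-hand side is
   nonpositive and [w = 0] suffices. *)
have [a0|a0] := leP 0%R a; have [b0|b0] := leP 0%R b.
- rewrite (ger0_norm a0) (ger0_norm b0).
  have := key (a + b)%R; rewrite -subr_sqr !expr2 => -> //.
  by have := sqr_ge0 (a - b)%R; rewrite expr2; lra.
- rewrite (ger0_norm a0) (ltr0_norm b0); apply: le_trans (key (a - b)%R _).
    by nra.
  by have := sqr_ge0 (a + b)%R; lra.
- rewrite (ltr0_norm a0) (ger0_norm b0); apply: le_trans (key 0%R _).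
    by nra.
  by have := sqr_ge0 a; have := sqr_ge0 b; lra.
- rewrite (ltr0_norm a0) (ltr0_norm b0); apply: le_trans (key (- (a + b))%R _).
    by lra.
  by have := sqr_ge0 (a - b)%R; lra.
Qed.

(** * Cheeger's inequality for a finite measure on a square with equal marginals *)

Section cheeger_inequality.
Context d (T : measurableType d) (R : realType).
Variables (nu : {finite_measure set T -> \bar R})
          (eta : {finite_measure set (T * T)%type -> \bar R}).
Hypothesis nu_fst : forall A, measurable A -> nu A = eta (A `*` setT).
Hypothesis nu_snd : forall A, measurable A -> nu A = eta (setT `*` A).

Lemma integral_fst (phi : T -> \bar R) :
  measurable_fun setT phi -> (forall x, 0 <= phi x) ->
  \int[eta]_p phi p.1 = \int[nu]_x phi x.
Proof.
move=> mphi phi0.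
have := @ge0_integral_pushforward _ _ _ _ _ _ (@measurable_fst _ _ T T) eta setT
  phi measurableT mphi (fun x _ => phi0 x).
rewrite preimage_setT => <-; apply: eq_measure_integral => A mA _.
by rewrite /= /pushforward -setXT; exact/esym/nu_fst.
Qed.

Lemma integral_snd (phi : T -> \bar R) :
  measurable_fun setT phi -> (forall x, 0 <= phi x) ->
  \int[eta]_p phi p.2 = \int[nu]_x phi x.
Proof.
move=> mphi phi0.
have := @ge0_integral_pushforward _ _ _ _ _ _ (@measurable_snd _ _ T T) eta setT
  phi measurableT mphi (fun x _ => phi0 x).
rewrite preimage_setT => <-; apply: eq_measure_integral => A mA _.
by rewrite /= /pushforward -setTX; exact/esym/nu_snd.
Qed.

Variable h : R.
Hypothesis h0 : (0 < h)%R.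
Hypothesis isoperimetry : forall A, measurable A ->
  h%:E * mine (nu A) (nu (~` A)) <= eta (A `*` ~` A).

(** Since 0 is a median of [g], the smaller side of a level cut is the upper one for [t >= 0] and
    the lower one for [t < 0], so the minimum in the isoperimetric bound is known at every level. *)
Lemma cheeger_centered (g : T -> R) : measurable_fun setT g ->
  nu [set x | (g x > 0)%R] <= nu [set x | (g x <= 0)%R] ->
  nu [set x | (g x < 0)%R] <= nu [set x | (g x >= 0)%R] ->
  \int[nu]_x ((g x) ^+ 2)%:E < +oo ->
  (h ^+ 2 / 8)%:E * \int[nu]_x ((g x) ^+ 2)%:E <=
  (2^-1)%:E * \int[eta]_p ((g p.2 - g p.1) ^+ 2)%:E.
Proof.
move=> mg gpos gneg Qfin.
(* [F] has the sign of [g] and absolute value [g^2]: cutting by levels of [F] recovers the integral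
   of [g^2] without losing the median property. *)
pose F x := (g x * `|g x|)%R.
have mF : measurable_fun setT F.
  by apply: measurable_funM => //; exact: measurableT_comp.
have m0 : measurable_fun setT (cst 0%R : T -> R) by [].
have Fgt0 x : (0 < F x)%R = (0 < g x)%R.
  rewrite /F; have [g0|g0|->] := ltgtP (g x) 0%R; last by rewrite mul0r ltxx.
    by apply/negbTE; rewrite -leNgt mulr_le0_ge0// ltW.
  by rewrite mulr_gt0// normr_gt0 gt_eqF.
have Flt0 x : (F x < 0)%R = (g x < 0)%R.
  rewrite /F; have [g0|g0|->] := ltgtP (g x) 0%R; last by rewrite mul0r ltxx.
    by rewrite nmulr_rlt0// normr_gt0 lt_eqF.
  by apply/negbTE; rewrite -leNgt mulr_ge0// ltW.
(* Three layer cakes: the positive part of [F], its negative part, and the decrease of [F] along an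
   edge. *)
have [mp pE] := layer_cake nu mF m0.
have [mn nE] := layer_cake nu m0 mF.
have mF1 : measurable_fun setT (fun p : T * T => F p.1) by exact: measurableT_comp.
have mF2 : measurable_fun setT (fun p : T * T => F p.2) by exact: measurableT_comp.
have [me eE] := layer_cake eta mF1 mF2.
set p_ := (fun t : R => nu _) in mp.
set n_ := (fun t : R => nu _) in mn.
set e_ := (fun t : R => eta _) in me.
(* At each level only one of [p_ t] and [n_ t] can be nonzero, and [e_ t] is the edge measure of the
   cut along [F > t]. *)
have step t : h%:E * (p_ t + n_ t) <= e_ t.
  have [t0|t0] := leP 0%R t.
    have -> : n_ t = 0.
      rewrite /n_ (_ : [set x | _] = set0) ?measure0//.
      rewrite -subset0 => x /= /andP[_]; apply/negP.
      by rewrite -leNgt.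
    rewrite adde0.
    pose A := [set x | (t < F x)%R].
    have mA : measurable A by exact: measurable_set_lt.
    have -> : p_ t = nu A by congr (nu _); apply/funext => x /=; rewrite t0.
    have -> : e_ t = eta (A `*` ~` A).
      congr (eta _); apply/funext => x /=; apply/propext; split.
        by move=> /andP[h1 h2]; split => //; apply/negP; rewrite -leNgt.
      by move=> [h1 /negP]; rewrite -leNgt => h2; apply/andP.
    apply: le_trans (isoperimetry mA).
    rewrite min_l//; apply: (@le_trans _ _ (nu [set x | (g x > 0)%R])).
      apply: le_measure; rewrite ?inE//; first exact: measurable_set_lt.
      by move=> x; rewrite /A /= -Fgt0; exact: le_lt_trans.
    apply: (le_trans gpos); apply: le_measure; rewrite ?inE.
    - exact: measurable_set_le.
    - exact: measurableC.
    - move=> x /=; rewrite leNgt -Fgt0 /A /= -leNgt => Fx; apply/negP.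
      by rewrite -leNgt (le_trans Fx).
  have -> : p_ t = 0.
    rewrite /p_ (_ : [set x | _] = set0) ?measure0//.
    by rewrite -subset0 => x /= /andP[]; rewrite leNgt t0.
  rewrite add0e.
  pose A := [set x | (t < F x)%R].
  have mA : measurable A by exact: measurable_set_lt.
  have ACE : ~` A = [set x | (F x <= t)%R].
    by apply/funext => x; apply/propext => /=; rewrite leNgt; split => /negP.
  have -> : n_ t = nu (~` A).
    by rewrite ACE; congr (nu _); apply/funext => x /=; rewrite t0 andbT.
  have -> : e_ t = eta (A `*` ~` A).
    rewrite ACE; congr (eta _); apply/funext => x /=; apply/propext; split.
      by move=> /andP[].
    by move=> [h1 h2]; apply/andP.
  apply: le_trans (isoperimetry mA).
  rewrite min_r//; apply: (@le_trans _ _ (nu [set x | (g x < 0)%R])).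
    apply: le_measure; rewrite ?inE.
    - exact: measurableC.
    - exact: measurable_set_lt.
    - by rewrite ACE => x /=; rewrite -Flt0 => /le_lt_trans; apply.
  apply: (le_trans gneg); apply: le_measure; rewrite ?inE//.
    exact: measurable_set_le.
  by move=> x /=; rewrite leNgt -Flt0 -leNgt /A/=; exact: lt_le_trans.
have msq : measurable_fun setT (fun x => ((g x) ^+ 2)%:E).
  by apply/measurable_EFinP; exact: measurable_funX.
have mmax (a b : T -> R) : measurable_fun setT a -> measurable_fun setT b ->
    measurable_fun setT (fun x => (Num.max (a x - b x) 0)%R%:E).
  move=> ma mb; apply/measurable_EFinP; apply: measurable_maxr => //.
  exact: measurable_funB.
have QE : \int[nu]_x ((g x) ^+ 2)%:E =
    \int[lebesgue_measure]_t (p_ t + n_ t).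
  rewrite ge0_integralD// -pE -nE -ge0_integralD//.
  - apply: eq_integral => x _; rewrite -EFinD; congr EFin.
    rewrite subr0 sub0r /F; have [g0|g0] := leP 0%R (g x).
      rewrite max_l ?mulr_ge0// max_r ?oppr_le0 ?mulr_ge0// addr0.
      by rewrite ger0_norm.
    have F0 : (g x * `|g x| <= 0)%R by rewrite mulr_le0_ge0// ltW.
    by rewrite (max_r F0) max_l ?oppr_ge0// add0r ltr0_norm// mulrN opprK.
  - by move=> x _; rewrite lee_fin le_max lexx orbT.
  - exact: mmax.
  - by move=> x _; rewrite lee_fin le_max lexx orbT.
  - exact: mmax.
have hQ : h%:E * \int[nu]_x ((g x) ^+ 2)%:E <=
    \int[eta]_p (Num.max (F p.1 - F p.2) 0)%R%:E.
  rewrite QE eE -ge0_integralZl_EFin ?(ltW h0)//.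
  - apply: ge0_le_integral => //.
    + by move=> t _; rewrite mule_ge0// ?adde_ge0// lee_fin ltW.
    + by apply: emeasurable_funM => //; exact: emeasurable_funD.
  - by move=> t _; rewrite adde_ge0.
  - exact: emeasurable_funD.
have mg1 : measurable_fun setT (fun p : T * T => g p.1) by exact: measurableT_comp.
have mg2 : measurable_fun setT (fun p : T * T => g p.2) by exact: measurableT_comp.
have msq1 c : measurable_fun setT (fun p : T * T => (c * (g p.1) ^+ 2)%:E).
  apply/measurable_EFinP; apply: measurable_funM => //; exact: measurable_funX.
have msq2 c : measurable_fun setT (fun p : T * T => (c * (g p.2) ^+ 2)%:E).
  apply/measurable_EFinP; apply: measurable_funM => //; exact: measurable_funX.
have mdiff : measurable_fun setT (fun p : T * T => ((g p.2 - g p.1) ^+ 2)%:E).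
  by apply/measurable_EFinP; apply: measurable_funX; exact: measurable_funB.
have h4 : (0 <= h / 4)%R by rewrite divr_ge0// ltW.
have h2 : (0 <= 2 / h)%R by rewrite divr_ge0// ltW.
have sq0 (c x : R) : (0 <= c)%R -> 0 <= (c * x ^+ 2)%:E.
  by move=> c0; rewrite lee_fin mulr_ge0// sqr_ge0.
have up : \int[eta]_p (Num.max (F p.1 - F p.2) 0)%R%:E <=
    (2 / h)%:E * \int[eta]_p ((g p.2 - g p.1) ^+ 2)%:E +
    ((h / 4)%:E * \int[nu]_x ((g x) ^+ 2)%:E + (h / 4)%:E * \int[nu]_x ((g x) ^+ 2)%:E).
  have mdiffc : measurable_fun setT
      (fun p : T * T => (2 / h * (g p.2 - g p.1) ^+ 2)%:E).
    by under eq_fun do rewrite EFinM; exact: emeasurable_funM.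
  (* Both marginals of [eta] are [nu], so each endpoint contributes the same quarter. *)
  have mid : (h / 4)%:E * \int[nu]_x ((g x) ^+ 2)%:E + (h / 4)%:E * \int[nu]_x ((g x) ^+ 2)%:E
      = \int[eta]_p ((h / 4 * g p.1 ^+ 2)%:E + (h / 4 * g p.2 ^+ 2)%:E).
    rewrite ge0_integralD//; try by move=> p _; exact: sq0.
    rewrite -{1}(integral_fst msq) -?(integral_snd msq); try by move=> x; rewrite lee_fin sqr_ge0.
    by congr (_ + _); rewrite -ge0_integralZl_EFin//; try (by move=> p _; rewrite lee_fin sqr_ge0);
      apply/measurable_EFinP; exact: measurable_funX.
  rewrite mid -ge0_integralZl_EFin//; last by move=> p _; rewrite lee_fin sqr_ge0.
  rewrite -ge0_integralD//; first last.
  - exact: emeasurable_funD.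
  - by move=> p _; rewrite adde_ge0// sq0.
  - by move=> p _; rewrite -EFinM sq0.
  apply: ge0_le_integral => //.
  - by move=> p _; rewrite lee_fin le_max lexx orbT.
  - by apply/measurable_EFinP; apply: measurable_maxr => //; exact: measurable_funB.
  - by apply: emeasurable_funD => //; exact: emeasurable_funD.
  - move=> p _; rewrite -!EFinM -!EFinD lee_fin ge_max signed_square_diff_le//=.
    by rewrite !addr_ge0// mulr_ge0// sqr_ge0.
have := le_trans hQ up.
have : 0 <= \int[nu]_x ((g x) ^+ 2)%:E.
  by apply: integral_ge0 => x _; rewrite lee_fin sqr_ge0.
have : 0 <= \int[eta]_p ((g p.2 - g p.1) ^+ 2)%:E.
  by apply: integral_ge0 => p _; rewrite lee_fin sqr_ge0.
move: Qfin; case: (\int[nu]_x _) => [Q| |]// _.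
case: (\int[eta]_p _) => [P| |]//; last first.
  by move=> _ _ _; rewrite gt0_muley ?leey// lte_fin.
rewrite -!EFinM -!EFinD !lee_fin => P0 Q0 le1.
(* Multiplying by [h] gives [h^2 Q <= 2 P + h^2 Q / 2]. As [Q] is finite, the last term can be
   absorbed on the left, and dividing by 4 gives the constant [1 / 8]. *)
have : (h * (h * Q) <= h * (2 / h * P + (h / 4 * Q + h / 4 * Q)))%R.
  by rewrite ler_wpM2l// ltW.
have -> : (h * (2 / h * P + (h / 4 * Q + h / 4 * Q)) = 2 * P + h ^+ 2 * Q / 2)%R.
  by field; rewrite gt_eqF.
by rewrite mulrA -expr2; lra.
Qed.

Lemma cheeger_inequality (f : T -> R) : measurable_fun setT f ->
  \int[nu]_x (f x)%:E = 0 -> \int[nu]_x ((f x) ^+ 2)%:E < +oo ->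
  (h ^+ 2 / 8)%:E * \int[nu]_x ((f x) ^+ 2)%:E <=
  (2^-1)%:E * \int[eta]_p ((f p.2 - f p.1) ^+ 2)%:E.
Proof.
move=> mf f_mean Qfin.
have [c [cgt clt]] := median_exists nu mf.
have msq : measurable_fun setT (EFin \o (fun x => (f x) ^+ 2)%R).
  by apply/measurable_EFinP; exact: measurable_funX.
have if2 : nu.-integrable setT (EFin \o (fun x => (f x) ^+ 2)%R).
  apply/integrableP; split => //.
  by under eq_integral do rewrite gee0_abs ?lee_fin ?sqr_ge0//.
have icst k : nu.-integrable setT (EFin \o cst k).
  exact: finite_measure_integrable_cst.
(* On a finite measure space square integrability suffices, through [|f| <= f^2 + 1]. *)
have if1 : nu.-integrable setT (EFin \o f).
  apply: (@le_integrable _ _ _ _ _ _ _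
    ((EFin \o (fun x => (f x) ^+ 2)%R) \+ (EFin \o cst 1%R))) => //.
  - exact/measurable_EFinP.
  - move=> x _ /=; rewrite lee_fin [leRHS]ger0_norm ?addr_ge0 ?sqr_ge0//.
    rewrite -real_normK ?num_real//; have := sqr_ge0 (`|f x| - 1)%R; nra.
  - exact: integrableD.
pose g x := (f x - c)%R.
have mg : measurable_fun setT g by exact: measurable_funB.
(* The cross term [-2 c f] integrates to zero, so a shift by any constant can only increase the norm
   of a mean-zero function. *)
have gE : \int[nu]_x ((g x) ^+ 2)%:E =
    \int[nu]_x ((f x) ^+ 2)%:E + (c ^+ 2)%:E * nu setT.
  transitivity (\int[nu]_x (((f x) ^+ 2)%:E + ((- (2 * c))%:E * (f x)%:E + (c ^+ 2)%:E))).
    apply: eq_integral => x _; rewrite -EFinM -!EFinD; congr EFin; rewrite /g; ring.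
  have if1Z : nu.-integrable setT (fun x => (- (2 * c))%:E * (f x)%:E).
    exact: integrableZl.
  have ic2 : nu.-integrable setT (fun=> (c ^+ 2)%:E) by exact: icst.
  rewrite integralD//; last exact: integrableD.
  rewrite integralD//.
  by rewrite integralZl// f_mean mule0 add0e integral_cst.
have fg : \int[nu]_x ((f x) ^+ 2)%:E <= \int[nu]_x ((g x) ^+ 2)%:E.
  by rewrite gE leeDl// mule_ge0// lee_fin sqr_ge0.
have gfin : \int[nu]_x ((g x) ^+ 2)%:E < +oo.
  by rewrite gE lte_add_pinfty// lte_mul_pinfty ?lee_fin ?sqr_ge0// ltey_eq fin_num_measure.
apply: (@le_trans _ _ ((h ^+ 2 / 8)%:E * \int[nu]_x ((g x) ^+ 2)%:E)).
  by rewrite lee_wpmul2l// lee_fin divr_ge0// sqr_ge0.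
have -> : \int[eta]_p ((f p.2 - f p.1) ^+ 2)%:E = \int[eta]_p ((g p.2 - g p.1) ^+ 2)%:E.
  by apply: eq_integral => p _; congr EFin; rewrite /g; ring.
apply: cheeger_centered => //.
- under eq_set do rewrite /g subr_gt0; under [X in _ <= nu X]eq_set do rewrite /g subr_le0.
  exact: cgt.
- under eq_set do rewrite /g subr_lt0; under [X in _ <= nu X]eq_set do rewrite /g subr_ge0.
  exact: clt.
Qed.

End cheeger_inequality.

(** * From graphings to the abstract inequality *)

(** Restriction to the whole space keeps all values and supplies the finite measure structure that
    the preceding sections require. *)
Lemma finite_measure_pack d (T : measurableType d) (R : realType)
    (m : {measure set T -> \bar R}) : m setT < +oo ->
  exists m' : {finite_measure set T -> \bar R}, m' = m :> (set T -> \bar R).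
Proof.
move=> mfin.
exists (mfrestr measurableT mfin); apply/funext => A /=.
by rewrite /mfrestr /mrestr setIT.
Qed.

Section graphing.
Context (R : realType) (mu : {measure set R -> \bar R}) (E : set (R * R)%type)
        (eta : {measure set (R * R)%type -> \bar R}).
Hypothesis graphingE : is_graphing mu E.
Hypothesis edge_eta : is_edge_measure mu E eta.
Local Notation I := (@I01 R).

Lemma degA_ge0 A x : 0 <= degA E A x.
Proof. by apply: esum_ge0 => y _; rewrite lee_fin. Qed.

Lemma degA_setI A : degA E A = degA E (A `&` I).
Proof.
case: graphingE => -[_ [EI _] _]; apply/funext => x; rewrite /degA.
congr (\esum_(y in _) _); apply/seteqP; split => y /=.
  by move=> [Ay Exy]; split => //; split => //; case: (EI _ Exy).
by move=> [[]].
Qed.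

Lemma degA_out A x : ~ I x -> degA E A x = 0.
Proof.
case: graphingE => -[_ [EI _] _] nIx; rewrite /degA (_ : [set y | _] = set0) ?esum_set0//.
by rewrite -subset0 => y /= [_ /EI[]].
Qed.

Lemma measurable_I01 : measurable I.
Proof. exact: measurable_itv. Qed.

Lemma integral_degA_setI A B :
  \int[mu]_(x in A) degA E B x = \int[mu]_(x in A `&` I) degA E B x.
Proof.
rewrite integral_mkcondr; apply: eq_integral => x _; rewrite patchE.
by case: ifPn => //; rewrite notin_setE => /degA_out ->.
Qed.

(** All edges have both endpoints in [I]. This reconciles the abstract section, whose sets range
    over the whole line, with definitions that use subsets of [I]. *)
Lemma eta_setI A B : measurable A -> measurable B ->
  eta (A `*` B) = eta ((A `&` I) `*` (B `&` I)).
Proof.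
move=> mA mB; have mI := measurable_I01.
rewrite !edge_eta//; try exact: measurableI.
by rewrite integral_degA_setI degA_setI.
Qed.

Lemma volG_eta A : measurable A -> volG mu E A = eta (A `*` setT).
Proof. by move=> mA; rewrite edge_eta// [in RHS]degA_setI setTI. Qed.

(** The symmetry axiom of a graphing, applied to [A] cut down to [I] and to [I] itself. *)
Lemma eta_marginals A : measurable A -> eta (A `*` setT) = eta (setT `*` A).
Proof.
move=> mA; have mI := measurable_I01; rewrite eta_setI// [RHS]eta_setI// !setTI.
rewrite !edge_eta//; try exact: measurableI.
by case: graphingE => _ [_]; apply => //; exact: measurableI.
Qed.

Lemma eta_setT_lty : eta setT < +oo.
Proof.
case: graphingE => -[_ [_ [_ [D degD]]]] [[muT _] _].
rewrite -setXTT edge_eta// degA_setI setTI.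
apply: (@le_lt_trans _ _ (\int[mu]_x (cst D%:R%:E x))).
  by apply: ge0_le_lower_integral => x _; rewrite ?degA_ge0.
by rewrite integral_cst// muT mule1 ltry.
Qed.

(** A consequence of bounded degree, used in contrapositive form: a side of nonzero volume has
    positive [mu]-measure. *)
Lemma volG_null A : measurable A -> mu A = 0 -> volG mu E A = 0.
Proof.
case: graphingE => -[_ [_ [_ [D degD]]]] _ mA muA0.
apply/eqP; rewrite eq_le; apply/andP; split; last first.
  by apply: integral_ge0 => x _; exact: degA_ge0.
apply: (@le_trans _ _ (\int[mu]_(x in A) (cst D%:R%:E x))).
  by apply: ge0_le_lower_integral => x _; rewrite ?degA_ge0.
by rewrite integral_cst// muA0 mule0.
Qed.

(** The trace [B] of [A] on [I] competes in the infimum as soon as both sides have nonzero volume;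
    otherwise the left-hand side vanishes. *)
Lemma cheeger_isoperimetry (h : R) A : h%:E <= cheeger mu E eta ->
  measurable A ->
  h%:E * mine (eta (A `*` setT)) (eta (~` A `*` setT)) <= eta (A `*` ~` A).
Proof.
move=> hc mA; have mI := measurable_I01; have mCA := measurableC mA.
have [_ [[muT muI] _]] := graphingE.
have CAI : ~` A `&` I = I `\` (A `&` I).
  by rewrite setDIr setDv setU0 setDE setIC.
set B := A `&` I in CAI.
have mB : measurable B by exact: measurableI.
have mIB : measurable (I `\` B) by exact: measurableD.
have -> : eta (A `*` setT) = volG mu E B.
  by rewrite volG_eta// eta_setI// [RHS]eta_setI// -setIA setIid.
have -> : eta (~` A `*` setT) = volG mu E (I `\` B).
  by rewrite volG_eta// eta_setI// [RHS]eta_setI// -CAI -setIA setIid.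
have -> : eta (A `*` ~` A) = eG eta B (I `\` B).
  by rewrite eta_setI// CAI.
have vol_fin C : measurable C -> volG mu E C \is a fin_num.
  move=> mC; rewrite ge0_fin_numE; last by apply: integral_ge0 => x _; exact: degA_ge0.
  rewrite volG_eta//; apply: le_lt_trans eta_setT_lty.
  by apply: le_measure; rewrite ?inE//; exact: measurableX.
have vol_ge0 C : 0 <= volG mu E C by apply: integral_ge0 => x _; exact: degA_ge0.
have e_ge0 : 0 <= eG eta B (I `\` B) by [].
have e_fin : eG eta B (I `\` B) \is a fin_num.
  rewrite ge0_fin_numE//; apply: le_lt_trans eta_setT_lty.
  by apply: le_measure; rewrite ?inE//; exact: measurableX.
set v := mine _ _.
have v_ge0 : 0 <= v by rewrite /v le_min !vol_ge0.
have v_fin : v \is a fin_num by rewrite /v minEle; case: ifPn => _; exact: vol_fin.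
have [v0|v0] := eqVneq v 0; first by rewrite v0 mule0.
have muB0 : 0 < mu B.
  rewrite lt0e measure_ge0 andbT; apply: contra_neq v0 => /(volG_null mB) volB.
  by rewrite /v volB min_l.
(* If [B] had full measure, its complement in [I] would be null, hence of zero volume, against
   [v != 0]. *)
have muB1 : mu B < 1.
  have muBE : mu B + mu (I `\` B) = 1.
    rewrite -measureU//; last by rewrite setDIK.
    by rewrite setDUK//; exact: subIsetr.
  rewrite lt_neqAle -{2}muBE leeDl// andbT; apply: contra_neq v0 => muB.
  rewrite /v (volG_null mIB) ?min_r//.
  move: muBE; rewrite muB; case: (mu (I `\` B)) => [x| |]// -[] x1.
  by congr EFin; lra.
have : h%:E <= (fine (eG eta B (I `\` B)) / fine v)%R%:E.
  apply: (le_trans hc); apply: ereal_inf_lbound; exists B; split => //.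
  - exact: subIsetr.
  - by rewrite muB0 muB1.
rewrite lee_fin ler_pdivlMr; last by rewrite fine_gt0// lt0e v0 v_ge0 ltey_eq v_fin.
by rewrite -lee_fin EFinM !fineK.
Qed.

Lemma cheeger_ge0 : 0 <= cheeger mu E eta.
Proof.
apply: le_ereal_inf_tmp => _ [A [mA AI _ ->]]; rewrite lee_fin divr_ge0// fine_ge0//.
by rewrite le_min; apply/andP; split; apply: integral_ge0 => x _; exact: degA_ge0.
Qed.

(** The abstract inequality is applied with [nu] the first marginal of [eta], which represents
    integration against [degA E I] for nonnegative measurable functions. *)
Lemma rayleigh_quotient_ge (h : R) (f : R -> R) :
  (0 < h)%R -> h%:E <= cheeger mu E eta -> measurable_fun setT f ->
  0 < normv2 mu E f < +oo -> \int[mu]_x ((f x)%:E * degA E I x) = 0 ->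
  (h ^+ 2 / 8)%:E <= norme2 eta f * ((fine (normv2 mu E f))^-1)%R%:E.
Proof.
move=> h0 hc mf /andP[Q0 Qfin] fmean.
have [_ [[muT muI] _]] := graphingE.
have [mu' mu'E] : exists m : {finite_measure set R -> \bar R}, m = mu :> (set R -> \bar R).
  by apply: finite_measure_pack; rewrite muT ltry.
have [eta' eta'E] := finite_measure_pack eta_setT_lty.
have [nu nuE] : exists m : {finite_measure set R -> \bar R}, m = pushforward eta fst :> (set R -> \bar R).
  apply: (@finite_measure_pack _ _ _
    (measure_function_pushforward__canonical__measure_function_Measure eta measurable_fst)).
  by rewrite /= /pushforward preimage_setT; exact: eta_setT_lty.
have nu_eta A : nu A = eta (A `*` setT) by rewrite nuE /pushforward setXT.
have deg_nu A : measurable A -> \int[mu']_(x in A) degA E I x = nu A.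
  by move=> mA; rewrite mu'E nu_eta -volG_eta.
have nuI (phi : R -> R) : measurable_fun setT phi -> (forall x, (0 <= phi x)%R) ->
    \int[mu]_x ((phi x)%:E * degA E I x) = \int[nu]_x (phi x)%:E.
  move=> mphi phi0; rewrite -mu'E; apply: lower_integral_density => // x.
  exact: degA_ge0.
have QE : normv2 mu E f = \int[nu]_x ((f x) ^+ 2)%:E.
  by apply: nuI; [exact: measurable_funX|move=> x; exact: sqr_ge0].
(* The density identity covers only nonnegative functions, so positive and negative parts are
   treated separately; as degrees are nonnegative, the parts of [f * deg] are those of [f] times
   [deg]. *)
have nu_mean : \int[nu]_x (f x)%:E = 0.
  rewrite -fmean [LHS]integralE [RHS]integralE; congr (_ - _).
    transitivity (\int[nu]_x (Num.max (f x) 0)%R%:E).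
      by apply: eq_integral => x _; rewrite funeposE EFin_max.
    rewrite -nuI; last by move=> x; rewrite le_max lexx orbT.
      apply: eq_integral => x _; rewrite funeposE /=; have u0 := degA_ge0 I x.
      have [fx|/ltW fx] := leP 0%R (f x).
        have fu : 0 <= (f x)%:E * degA E I x by rewrite mule_ge0 ?lee_fin.
        by rewrite (max_l fu).
      have fu : (f x)%:E * degA E I x <= 0 by rewrite mule_le0_ge0 ?lee_fin.
      by rewrite (max_r fu) mul0e.
    exact: measurable_maxr.
  transitivity (\int[nu]_x (Num.max (- f x) 0)%R%:E).
    by apply: eq_integral => x _; rewrite funenegE EFin_max EFinN.
  rewrite -nuI; last by move=> x; rewrite le_max lexx orbT.
    apply: eq_integral => x _; rewrite funenegE /=; have u0 := degA_ge0 I x.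
    have [fx|/ltW fx] := leP 0%R (f x).
      have fu : - ((f x)%:E * degA E I x) <= 0 by rewrite oppe_le0 mule_ge0 ?lee_fin.
      by rewrite (max_r fu) max_r ?oppr_le0// mul0e.
    have fu : 0 <= - ((f x)%:E * degA E I x) by rewrite oppe_ge0 mule_le0_ge0 ?lee_fin.
    by rewrite (max_l fu) max_l ?oppr_ge0// EFinN mulNe.
  by apply: measurable_maxr => //; exact: measurableT_comp.
have := @cheeger_inequality _ _ _ nu eta' _ _ h h0 _ f mf nu_mean.
rewrite eta'E -QE => core.
have {core} := core _ _ _ Qfin.
rewrite /norme2 -[X in _ * X <= _](@fineK _ (normv2 mu E f)) ?gt0_fin_numE//.
rewrite lee_pdivlMr ?fine_gt0 ?Q0//; apply.
- by move=> A mA; exact: nu_eta.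
- by move=> A mA; rewrite nu_eta eta_marginals.
- by move=> A mA; rewrite !nu_eta; exact: cheeger_isoperimetry.
Qed.

End graphing.

(** * Passage to the infima *)

Unset Implicit Arguments.

Theorem mainTheorem4 (R : realType) (mu : {measure set R -> \bar R})
    (E : set (R * R)) (eta : {measure set (R * R) -> \bar R}) :
  is_graphing mu E -> is_edge_measure mu E eta -> connected_graphing mu eta ->
  cheeger mu E eta * cheeger mu E eta * (8^-1)%R%:E <= lambdaG mu E eta.
Proof.
move=> graphingE edge_eta _.
apply: le_ereal_inf_tmp => _ [f [mf Q fmean ->]].
have key h h0 hc := @rayleigh_quotient_ge _ _ _ _ graphingE edge_eta h f h0 hc mf Q fmean.
set r := _ * _ in key *.
have r_ge0 : 0 <= r.
  rewrite mule_ge0 ?lee_fin ?invr_ge0 ?fine_ge0//; last by case/andP: Q => /ltW.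
  by rewrite mule_ge0 ?lee_fin// integral_ge0// => p _; rewrite lee_fin sqr_ge0.
have := cheeger_ge0 mu E eta.
case: (cheeger mu E eta) key => [c| |]// key c0.
  rewrite -!EFinM -expr2.
  have [->|c_neq0] := eqVneq c 0%R; first by rewrite expr0n mul0r.
  by apply: key => //; rewrite lt_neqAle eq_sym c_neq0 -lee_fin.
(* The Cheeger constant is infinite when no admissible set exists. Then [key] holds for every
   positive [h], and [h = r + 8] refutes a finite [r], since [(r + 8)^2 / 8 > r] for [r >= 0]. *)
rewrite mulyy gt0_mulye ?lte_fin// leye_eq.
move: r_ge0 key; case: r => [r| |]// r0 key; exfalso.
have := key (r + 8)%R; rewrite leey lee_fin => /(_ _ isT).
by rewrite lee_fin in r0; nra.
Qed.
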